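(* Let $n \ge 1$ be an integer, let $j \in \{1,\dots,2n\}$, and let $N = n^2 + j$. If the continued fraction of $\sqrt{N}$ has period of length $3$, then $j$ is an odd number and $\sqrt{N} = [n, \overline{x, x, 2n}]$, where $x$ is an even number.
   Context: The (simple) continued fraction expansion of an irrational real number $x$ is the unique infinite sequence $[a_0,a_1,a_2,\dots]$ with $a_0\in\mathbb Z$ and $a_i$ a positive integer for $i\ge 1$, such that the convergents $a_0+\cfrac{1}{a_1+\cfrac{1}{\ddots+\cfrac{1}{a_m}}}$ converge to $x$ as $m\to\infty$. The notation $[a_0,\dots,a_k,\overline{a_{k+1},\dots,a_\ell}]$ means that the block $a_{k+1},\dots,a_\ell$ is repeated infinitely many times after the preperiod $a_0,\dots,a_k$. For $N=n^2+j$ with $1\le j\le 2n$, the continued fraction of $\sqrt N$ has the form $[n,\overline{a_1,\dots,a_r,2n}]$. To say that it ''has period of length $\ell$'' means that it can be written in the form $[n,\overline{a_1,\dots,a_{\ell-1},2n}]$ with a repeating block of $\ell$ entries; the block is not required to be of minimal length. *)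

(* Defs.v *)
From Stdlib Require Import Reals ZArith List.
From Coquelicot Require Import Coquelicot.
Import ListNotations.

(* convergent a m = a_0 + 1/(a_1 + 1/(... + 1/a_m)).  Division by zero never
   arises when a_i > 0 for all i >= 1. *)
Fixpoint convergent (a : nat -> Z) (m : nat) : R :=
  match m with
  | O => IZR (a O)
  | S m' => (IZR (a O) + / convergent (fun i => a (S i)) m')%R
  end.

(* x = [a_0, a_1, a_2, ...]; such an x is automatically irrational. *)
Definition is_cont_frac (x : R) (a : nat -> Z) : Prop :=
  (forall i : nat, (1 <= i)%nat -> (0 < a i)%Z) /\
  is_lim_seq (convergent a) (Finite x).

(* The sequence pre, block, block, ...; only meaningful when block is not
   empty (the values 0 given as defaults are then never reached). *)
Definition ult_periodic (pre block : list Z) (i : nat) : Z :=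
  if (i <? length pre)%nat then nth i pre 0%Z
  else nth ((i - length pre) mod length block)%nat block 0%Z.

(* The continued fraction of x can be written with initial entry n and a
   repeating block of l entries ending in 2n, not necessarily of minimal
   length. *)
Definition has_period_length (x : R) (n : Z) (l : nat) : Prop :=
  exists s : list Z,
    S (length s) = l /\
    is_cont_frac x (ult_periodic [n] (s ++ [(2 * n)%Z])).

(* Main.v *)
Require Import Defs.
From Stdlib Require Import Reals ZArith List.
From Stdlib Require Import Lra Lia.
From Coquelicot Require Import Coquelicot.
Import ListNotations.
Open Scope Z_scope.

(** Write [y = sqrt N + n], so that [y^2 = 2ny + j] and [sqrt N - n = j / y].  The expansion
    [n, p, q, 2n, p, q, 2n, ...] of [sqrt N] says that [y / j = p + 1 / (q + 1 / y)]; after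
    clearing denominators and reducing [y^2], this is an integral linear relation
    [(2nq + 1 - j(pq + 1)) y = j(p - q)].  As [y] is irrational, [p = q] and
    [j(p^2 + 1) = 2np + 1].  The right side is odd, so [j] and [p^2 + 1] are odd. *)

Lemma convergent_ext (a b : nat -> Z) (m : nat) :
  (forall i, a i = b i) -> convergent a m = convergent b m.
Proof.
  revert a b; induction m as [|m IH]; intros a b Hab; simpl.
  - now rewrite Hab.
  - rewrite Hab; do 2 f_equal; apply IH; intros i; apply Hab.
Qed.

Lemma convergent_S (a : nat -> Z) (m : nat) :
  convergent a (S m) = (IZR (a O) + / convergent (fun i => a (S i)) m)%R.
Proof. reflexivity. Qed.

Lemma is_lim_seq_Rinv (u : nat -> R) (l : R) :
  l <> 0%R -> is_lim_seq u l -> is_lim_seq (fun m => / u m)%R (/ l)%R.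
Proof.
  intros Hl Hu.
  apply (is_lim_seq_inv u (Finite l)); [exact Hu | intros H; now injection H].
Qed.

(** The entry [2 * n] is split as [n + n]: the second [n] serves as the leading entry of a fresh
    copy of the expansion, since shifting the sequence by four or by one leaves the same tail. The
    offset [m + 1] guarantees that this copy has a tail to unfold. *)
Lemma convergent_period_3 (n p q : Z) (m : nat) :
  let a := ult_periodic [n] [p; q; 2 * n] in
  convergent a (m + 4) =
  (IZR n + / (IZR p + / (IZR q + / (IZR n + convergent a (m + 1)))))%R.
Proof.
  intros a.
  replace (m + 4)%nat with (S (S (S (S m)))) by lia.
  replace (m + 1)%nat with (S m) by lia.
  rewrite !convergent_S.
  change (a O) with n; change (a 1%nat) with p.
  change (a 2%nat) with q; change (a 3%nat) with (2 * n)%Z.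
  rewrite (convergent_ext (fun i => a (S (S (S (S i))))) (fun i => a (S i))).
  - rewrite mult_IZR, <- Rplus_assoc.
    now replace (2 * IZR n)%R with (IZR n + IZR n)%R by ring.
  - intros i; unfold a, ult_periodic; cbn [length Nat.ltb Nat.leb].
    replace (S (S (S (S i))) - 1)%nat with (i + 1 * 3)%nat by lia.
    rewrite Nat.Div0.mod_add.
    now replace (S i - 1)%nat with i by lia.
Qed.

(** Passage to the limit in the recurrence of the convergents; positivity keeps every limit that is
    inverted away from 0. *)
Lemma cont_frac_period_3_eq (x : R) (n p q : Z) :
  (0 < x + IZR n)%R -> 0 < p -> 0 < q ->
  is_lim_seq (convergent (ult_periodic [n] [p; q; 2 * n])) x ->
  x = (IZR n + / (IZR p + / (IZR q + / (IZR n + x))))%R.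
Proof.
  intros Hx Hp%IZR_lt Hq%IZR_lt Hlim.
  assert (H1 : (0 < / (IZR n + x))%R) by (apply Rinv_0_lt_compat; lra).
  assert (H2 : (0 < / (IZR q + / (IZR n + x)))%R) by (apply Rinv_0_lt_compat; lra).
  set (a := ult_periodic [n] [p; q; 2 * n]) in *.
  assert (E1 : is_lim_seq (fun m => convergent a (m + 4)) x)
    by now apply (is_lim_seq_incr_n (convergent a)).
  assert (E2 : is_lim_seq (fun m => convergent a (m + 4))
    (IZR n + / (IZR p + / (IZR q + / (IZR n + x))))%R).
  { eapply is_lim_seq_ext;
      [intros m; symmetry; apply convergent_period_3 |].
    apply is_lim_seq_plus'; [apply is_lim_seq_const |].
    apply is_lim_seq_Rinv; [lra |].
    apply is_lim_seq_plus'; [apply is_lim_seq_const |].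
    apply is_lim_seq_Rinv; [lra |].
    apply is_lim_seq_plus'; [apply is_lim_seq_const |].
    apply is_lim_seq_Rinv; [lra |].
    apply is_lim_seq_plus'; [apply is_lim_seq_const |].
    now apply (is_lim_seq_incr_n (convergent a)). }
  apply is_lim_seq_unique in E1; apply is_lim_seq_unique in E2.
  rewrite E1 in E2; now injection E2.
Qed.

(* Descent: if [k x] is an integer then so is [k' x] for [k' = k (x - n) < k]. *)
Lemma sqrt_between_irrational (x : R) (n N : Z) :
  (x * x = IZR N)%R -> (IZR n < x < IZR n + 1)%R ->
  forall k c : Z, 0 < k -> (IZR k * x)%R <> IZR c.
Proof.
  intros Hx Hn k c Hk; revert c.
  assert (Hk0 : 0 <= k) by lia; revert Hk.
  pattern k; apply Z_lt_induction; [clear k Hk0 | exact Hk0].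
  intros k IH Hk c Hc.
  assert (Hk' := IZR_lt _ _ Hk).
  assert (E : IZR (c - n * k) = (IZR k * (x - IZR n))%R)
    by (rewrite minus_IZR, mult_IZR, <- Hc; ring).
  assert (Hpos : 0 < c - n * k) by (apply lt_IZR; rewrite E; nra).
  assert (Hlt : c - n * k < k) by (apply lt_IZR; rewrite E; nra).
  (* The last argument is the integer value of [(c - n * k) * x], because
     [c * x = k * x * x = k * N] and [n * k * x = n * c]. *)
  apply (IH (c - n * k) (conj (Z.lt_le_incl _ _ Hpos) Hlt) Hpos (k * N - n * c)).
  rewrite E, minus_IZR, !mult_IZR, <- Hx, <- Hc; ring.
Qed.

(** The descent excludes a positive multiplier; a negative [A] is reduced to that case by changing
    both signs. *)
Lemma sqrt_between_linear_relation (x : R) (n N A B : Z) :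
  (x * x = IZR N)%R -> (IZR n < x < IZR n + 1)%R ->
  (IZR A * x)%R = IZR B -> A = 0 /\ B = 0.
Proof.
  intros Hx Hn HAB.
  assert (A = 0) as ->.
  { destruct (Z.lt_trichotomy A 0) as [H | [H | H]]; [exfalso | exact H | exfalso].
    - apply (sqrt_between_irrational x n N Hx Hn (- A) (- B)); [lia |].
      rewrite !opp_IZR, <- HAB; ring.
    - exact (sqrt_between_irrational x n N Hx Hn A B H HAB). }
  split; [reflexivity | apply eq_IZR; rewrite <- HAB; ring].
Qed.

Theorem mainTheorem2 (n j N : Z) (hn : 1 <= n) (hj : 1 <= j <= 2 * n)
    (hN : N = n ^ 2 + j)
    (hper : has_period_length (sqrt (IZR N)) n 3) :
  Z.Odd j /\
  exists x : Z,
    Z.Even x /\ is_cont_frac (sqrt (IZR N)) (ult_periodic [n] [x; x; 2 * n]).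
Proof.
  destruct hper as [s [Hs Hcf]].
  destruct s as [|p [|q [|r s]]]; simpl in Hs; try discriminate Hs; clear Hs.
  cbn [app] in Hcf.
  destruct (Hcf) as [Hpos Hlim].
  assert (Hp : 0 < p) by exact (Hpos 1%nat ltac:(lia)).
  assert (Hq : 0 < q) by exact (Hpos 2%nat ltac:(lia)).
  assert (HN0 : (0 <= IZR N)%R) by (apply IZR_le; nia).
  assert (Hx := sqrt_sqrt _ HN0).
  assert (Hx0 := sqrt_pos (IZR N)).
  set (x := sqrt (IZR N)) in *.
  assert (HNR : IZR N = (IZR n * IZR n + IZR j)%R)
    by (rewrite <- mult_IZR, <- plus_IZR; f_equal; lia).
  assert (HnR := IZR_le _ _ hn).
  assert (HjR := IZR_le _ _ (proj1 hj)).
  assert (HjR' := IZR_le _ _ (proj2 hj)); rewrite mult_IZR in HjR'.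
  (* From [1 <= j <= 2 * n], the integer [N] lies strictly between [n ^ 2] and [(n + 1) ^ 2]. *)
  assert (Hn : (IZR n < x < IZR n + 1)%R) by (split; nra).
  assert (E := cont_frac_period_3_eq x n p q ltac:(lra) Hp Hq Hlim).
  assert (HpR := IZR_lt _ _ Hp); assert (HqR := IZR_lt _ _ Hq).
  assert (Hfrac : ((x - IZR n) * (IZR p * (IZR q * (x + IZR n) + 1) + (x + IZR n))
                   = IZR q * (x + IZR n) + 1)%R).
  { replace (x - IZR n)%R
      with (/ (IZR p + / (IZR q + / (IZR n + x))))%R by lra.
    assert (Hy : (0 < IZR n + x)%R) by lra.
    assert (Hqy := Rmult_lt_0_compat _ _ HqR Hy).
    assert (Hpqy := Rmult_lt_0_compat _ _ HpR Hqy).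
    field; repeat split; lra. }
  (* [A] is the coefficient of [y = x + n] in the linear relation; the term [A * n] moves to the
     right to leave a multiple of [x]. *)
  set (A := 2 * n * q + 1 - j * (p * q + 1)).
  assert (Hlin : (IZR A * x)%R = IZR (j * (p - q) - A * n)).
  { unfold A.
    repeat rewrite ?minus_IZR, ?plus_IZR, ?mult_IZR.
    assert (Hj : IZR j = ((x - IZR n) * (x + IZR n))%R) by (rewrite HNR in Hx; lra).
    (* The extra factor [x + n] turns [x - n] into [j]. *)
    apply (f_equal (Rmult (x + IZR n))) in Hfrac.
    rewrite Hj; lra. }
  destruct (sqrt_between_linear_relation x n N _ _ Hx Hn Hlin) as [HA HB].
  rewrite HA, Z.mul_0_l, Z.sub_0_r in HB.
  assert (q = p) as -> by (apply Z.mul_eq_0 in HB; lia).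
  assert (Hj : j * (p * p + 1) = 2 * (n * p) + 1) by (unfold A in HA; lia).
  assert (Hodd : Z.odd (j * (p * p + 1)) = true)
    by (apply Z.odd_spec; exists (n * p); exact Hj).
  rewrite Z.odd_mul, Z.odd_add, Z.odd_mul in Hodd.
  change (Z.odd 1) with true in Hodd.
  split.
  - apply Z.odd_spec; now destruct (Z.odd j).
  (* Since [q = p], the given expansion already has the required shape; [p] is even because
     [p * p + 1] is odd. *)
  - exists p; split; [| exact Hcf].
    apply Z.even_spec; rewrite <- Z.negb_odd.
    now destruct (Z.odd p), (Z.odd j).
Qed.
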